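(* Let $\gamma,\omega\in\mathbb R$ and view $p^{kag}$ as the function $(x,\xi)\mapsto p^{kag}(x,\xi,\gamma,\omega)$ on $\mathbb R^2$. Then $$p^{kag}\circ\tilde t_1=p^{kag},\qquad p^{kag}\circ\tilde t_2=p^{kag},$$ $$\begin{pmatrix}0&1&0\\0&0&1\\1&0&0\end{pmatrix}^{-1}\big(p^{kag}\circ({}^t\kappa)^2\big)\begin{pmatrix}0&1&0\\0&0&1\\1&0&0\end{pmatrix}=p^{kag},$$ $$\begin{pmatrix}0&0&1\\0&1&0\\1&0&0\end{pmatrix}\overline{\big(p^{kag}\circ s\big)}\begin{pmatrix}0&0&1\\0&1&0\\1&0&0\end{pmatrix}=p^{kag}.$$
   Context: The bar is entrywise complex conjugation. On $\mathbb R_x\times\mathbb R_\xi$: $\tilde t_1(x,\xi)=(x+2\pi,\xi)$, $\tilde t_2(x,\xi)=(x,\xi+2\pi)$, $s(x,\xi)=(\xi,x)$, ${}^t\kappa(x,\xi)=(\xi,-x+\xi)$, and $$p^{kag}(x,\xi,\gamma,\omega)=\begin{pmatrix}0&e^{i(\omega+\frac\gamma8)}(e^{-ix}+e^{-i(x-\xi)})&e^{-i(\omega+\frac\gamma8)}(e^{-ix}+e^{-i\xi})\\ e^{-i(\omega+\frac\gamma8)}(e^{ix}+e^{i(x-\xi)})&0&e^{i(\omega+\frac\gamma8)}(e^{i(x-\xi)}+e^{-i\xi})\\ e^{i(\omega+\frac\gamma8)}(e^{ix}+e^{i\xi})&e^{-i(\omega+\frac\gamma8)}(e^{-i(x-\xi)}+e^{i\xi})&0\end{pmatrix}.$$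 *)

(* Defs.v *)
From mathcomp Require Import all_boot all_order all_algebra.
From mathcomp Require Import complex.
From mathcomp Require Import reals trigo.

Set Implicit Arguments.
Unset Strict Implicit.
Unset Printing Implicit Defensive.

Import Order.TTheory GRing.Theory Num.Theory.
Local Open Scope ring_scope.

(* e^{it} for real t; the library has no complex exponential. *)
Definition expi (R : realType) (t : R) : R[i] := Complex (cos t) (sin t).

Definition mx3 (K : nzRingType) (rows : seq (seq K)) : 'M[K]_3 :=
  \matrix_(i < 3, j < 3) nth 0 (nth [::] rows i) j.

Definition t1 (R : realType) (v : R * R) : R * R := (v.1 + 2 * pi, v.2).

Definition t2 (R : realType) (v : R * R) : R * R := (v.1, v.2 + 2 * pi).

Definition swap (R : realType) (v : R * R) : R * R := (v.2, v.1).

Definition tkappa (R : realType) (v : R * R) : R * R := (v.2, - v.1 + v.2).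

Definition pkag (R : realType) (x xi gamma omega : R) : 'M[R[i]]_3 :=
  mx3
    [:: [:: 0;
            expi (omega + gamma / 8) * (expi (- x) + expi (- (x - xi)));
            expi (- (omega + gamma / 8)) * (expi (- x) + expi (- xi))];
        [:: expi (- (omega + gamma / 8)) * (expi x + expi (x - xi));
            0;
            expi (omega + gamma / 8) * (expi (x - xi) + expi (- xi))];
        [:: expi (omega + gamma / 8) * (expi x + expi xi);
            expi (- (omega + gamma / 8)) * (expi (- (x - xi)) + expi xi);
            0]].

(* Main.v *)
Require Import Defs.
From mathcomp Require Import all_boot all_order all_algebra.
From mathcomp Require Import complex.
From mathcomp Require Import reals trigo.
From mathcomp Require Import boolp ring.

Import Order.TTheory GRing.Theory Num.Theory.
Local Open Scope ring_scope.

(** Every entry of [pkag] depends on $(x,\xi)$ only through $e^{\pm ix}$, $e^{\pm i\xi}$, $e^{\pm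
    i(x-\xi)}$, so periodicity is that of [expi]. The square of [tkappa] cycles the phases
    $x\mapsto\xi-x\mapsto-\xi\mapsto x$, and conjugation by [P] cycles the three indices to match.
    Composing [swap] with conjugation sends $x\mapsto-\xi$, $\xi\mapsto-x$, fixes $x-\xi$ and
    negates $\omega+\gamma/8$; [J] exchanges the outer indices and so undoes this. [mul_mx3] reduces
    the matrix identities to entries. *)

Lemma expiD2pi (R : realType) (t : R) : expi (t + 2 * pi) = expi t.
Proof. by rewrite /expi mulr_natl cosD2pi sinD2pi. Qed.

Lemma expiB2pi (R : realType) (t : R) : expi (t - 2 * pi) = expi t.
Proof. by rewrite -expiD2pi subrK. Qed.

Lemma conjc_expi (R : realType) (t : R) : conjc (expi t) = expi (- t).
Proof. by rewrite /expi cosN sinN. Qed.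

(** Tailored to the common shape of the off-diagonal entries of [pkag]. *)
Lemma conjc_expi_mulD (R : realType) (s t u : R) :
  conjc (expi s * (expi t + expi u)) = expi (- s) * (expi (- t) + expi (- u)).
Proof. by rewrite -!conjc_expi -rmorphD -rmorphM. Qed.

Lemma mul_mx3 (K : nzRingType) (a b c d e f g h i a' b' c' d' e' f' g' h' i' : K) :
  mx3 [:: [:: a; b; c]; [:: d; e; f]; [:: g; h; i]] *m
  mx3 [:: [:: a'; b'; c']; [:: d'; e'; f']; [:: g'; h'; i']] =
  mx3 [:: [:: a * a' + b * d' + c * g'; a * b' + b * e' + c * h';
              a * c' + b * f' + c * i'];
          [:: d * a' + e * d' + f * g'; d * b' + e * e' + f * h';
              d * c' + e * f' + f * i'];
          [:: g * a' + h * d' + i * g'; g * b' + h * e' + i * h';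
              g * c' + h * f' + i * i']].
Proof.
by apply/matrixP => -[[|[|[|//]]] ?] [[|[|[|//]]] ?];
  rewrite !mxE !big_ord_recl big_ord0 !mxE /= addr0 addrA.
Qed.

(** The condition on [f] handles entries beyond the given lists, where [nth] returns its default
    [0]. *)
Lemma map_mx3 (K L : nzRingType) (f : K -> L) (rows : seq (seq K)) :
  f 0 = 0 -> map_mx f (mx3 rows) = mx3 (map (map f) rows).
Proof.
move=> f0; apply/matrixP => i j; rewrite !mxE.
have f_nth s k : f (nth 0 s k) = nth 0 (map f s) k.
  by elim: s k => [|x s IHs] [|k] //=.
rewrite f_nth; congr nth.
by elim: rows {i}(i : nat) => [|r rows IHrows] [|k] /=.
Qed.

Lemma mx3_1 (K : nzRingType) :
  mx3 [:: [:: 1; 0; 0]; [:: 0; 1; 0]; [:: 0; 0; 1]] = 1%:M :> 'M[K]_3.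
Proof.
by apply/matrixP => -[[|[|[|//]]] ?] [[|[|[|//]]] ?]; rewrite !mxE.
Qed.

Lemma cycle_mx3_unit (K : comUnitRingType) :
  mx3 [:: [:: 0; 1; 0]; [:: 0; 0; 1]; [:: 1; 0; 0]] \in @unitmx K 3.
Proof.
(* The inverse of a permutation matrix is its transpose. *)
suff /mulmx1_unit[]: mx3 [:: [:: 0; 1; 0]; [:: 0; 0; 1]; [:: 1; 0; 0]] *m
  mx3 [:: [:: 0; 0; 1]; [:: 1; 0; 0]; [:: 0; 1; 0]] = 1%:M :> 'M[K]_3 by [].
by rewrite mul_mx3 !(mul0r, mulr0, mul1r, add0r, addr0) mx3_1.
Qed.

Theorem proposition1p17 (R : realType) (gamma omega : R) :
  let p : R * R -> 'M[R[i]]_3 := fun v => pkag v.1 v.2 gamma omega in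
  let P : 'M[R[i]]_3 := mx3 [:: [:: 0; 1; 0]; [:: 0; 0; 1]; [:: 1; 0; 0]] in
  let J : 'M[R[i]]_3 := mx3 [:: [:: 0; 0; 1]; [:: 0; 1; 0]; [:: 1; 0; 0]] in
  [/\ p \o @t1 R = p,
      p \o @t2 R = p,
      (fun v => invmx P *m (p \o (@tkappa R \o @tkappa R)) v *m P) = p &
      (fun v => J *m map_mx conjc ((p \o @swap R) v) *m J) = p].
Proof.
have simpl01 := (mul0r, mulr0, mul1r, mulr1, add0r, addr0).
move=> p P J; split; apply/funext => -[x xi] /=.
- rewrite /p /t1 /pkag /=.
  have -> : x + 2 * pi - xi = x - xi + 2 * pi by ring.
  by rewrite !(opprD, opprK, expiD2pi, expiB2pi).
- rewrite /p /t2 /pkag /=.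
  have -> : x - (xi + 2 * pi) = x - xi - 2 * pi by ring.
  by rewrite !(opprD, opprK, expiD2pi, expiB2pi).
(* Moving [P] to the other side leaves $MP=Pp$, with $M$ the transformed symbol, so the inverse is
   never computed. *)
- rewrite -mulmxA; apply: canLR (mulKmx (cycle_mx3_unit _)) _.
  rewrite /p /tkappa /pkag /P /= !mul_mx3 !simpl01.
  (* The images of $x$, $\xi$ and $x-\xi$ under the squared map are $\xi-x$, $-x$ and $\xi$. *)
  have -> : - x + xi = xi - x by ring.
  have -> : - xi + (xi - x) = - x by ring.
  have -> : xi - x - - x = xi by ring.
  (* Both sides now agree up to the order of the two exponentials in each entry. *)
  rewrite !(opprB, opprK) (addrC (expi (x - xi)) (expi x)).
  by rewrite (addrC (expi xi) (expi x)) (addrC (expi (xi - x)) (expi (- x)))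
    (addrC (expi (- xi)) (expi (- x))).
- rewrite /p /swap /pkag /J [(x, xi).1]/= [(x, xi).2]/=.
  rewrite (map_mx3 _ _ _ _ (conjc0 _)) /map !mul_mx3 !simpl01.
  rewrite ![(xi, x).1]/= ![(xi, x).2]/= !conjc_expi_mulD !conjc0.
  rewrite !(opprB, opprK) (addrC (expi (x - xi)) (expi x)).
  rewrite (addrC (expi xi) (expi x)) (addrC (expi (xi - x)) (expi (- x))).
  by rewrite (addrC (expi (- xi)) (expi (- x)))
    (addrC (expi (x - xi)) (expi (- xi))) (addrC (expi (xi - x)) (expi xi)).
Qed.
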